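(* Let $F=F(a,b,c)$ be the free group on $a,b,c$ and let $H=\langle a^4,\ a^2ba,\ aca^2,\ bc^{-1}\rangle<F$. Then $H$ is not an S-subgroup of $F$ and $H$ does not have ACEP in $F$.
   Context: For a group $K$ and $w\in K$, $w^K=\{k^{-1}wk\mid k\in K\}$ is the conjugacy class of $w$ in $K$. A subgroup $H<F$ is an S-subgroup of $F$ if there exists $w\in H$ such that $w^H\ne w^F\cap H$. A subgroup $H$ of $F$ has ACEP (Almost Congruence Extension Property) in $F$ if there is a finite set $\Phi\subset H$ of nontrivial elements such that for every normal subgroup $N$ of $H$ with $N\cap\Phi=\emptyset$ one has $H\cap\langle\langle N\rangle\rangle_F=N$, where $\langle\langle N\rangle\rangle_F$ is the normal closure of $N$ in $F$. *)

(* Defs.v *)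
From HB Require Import structures.
From mathcomp Require Import all_boot.
From mathcomp Require Import boolp classical_sets cardinality.

Set Implicit Arguments.
Unset Strict Implicit.
Unset Printing Implicit Defensive.

Local Open Scope group_scope.
Local Open Scope classical_set_scope.

(* Words over a choiceType X of generators: the letter (x, false) stands for x
   and (x, true) for its inverse. *)
Section FreeGroup.
Variable X : choiceType.
Implicit Types (l m : X * bool) (s t u : seq (X * bool)).

Definition inv_letter l : X * bool := (l.1, ~~ l.2).

Definition reduced s : bool := sorted (fun l m => m != inv_letter l) s.

Definition push l s : seq (X * bool) :=
  if s is m :: t then if m == inv_letter l then t else l :: s else [:: l].

Definition inv_word s : seq (X * bool) := rev (map inv_letter s).

Lemma inv_letterK : involutive inv_letter.
Proof. by case=> x b; rewrite /inv_letter /= negbK. Qed.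

Lemma push_reduced l s : reduced s -> reduced (push l s).
Proof.
case: s => [|m s] //= ps; case: ifPn => [_|ml]; last by rewrite /= ml.
exact: path_sorted ps.
Qed.

Lemma foldr_push_reduced s u : reduced s -> reduced (foldr push s u).
Proof. by move=> rs; elim: u => //= l u; apply: push_reduced. Qed.

Lemma pushVK l s : reduced s -> push l (push (inv_letter l) s) = s.
Proof.
case: s => [|m s] /= rs; first by rewrite eqxx.
rewrite inv_letterK; case: ifPn => [/eqP e|_] /=; last by rewrite eqxx.
by subst m; case: s rs => [|k s] //= /andP[/negPf-> _].
Qed.

Lemma pushKV l s : reduced s -> push (inv_letter l) (push l s) = s.
Proof. by move=> rs; rewrite -{2}[l]inv_letterK pushVK. Qed.

Lemma foldr_push_push l s u :
  reduced s -> foldr push s (push l u) = push l (foldr push s u).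
Proof.
move=> rs; case: u => [|m u] //=; case: eqP => [->|//].
by rewrite pushVK // foldr_push_reduced.
Qed.

Lemma foldr_push_id s : reduced s -> foldr push [::] s = s.
Proof.
elim: s => [|l s IH] //= ps; rewrite IH; last exact: path_sorted ps.
by case: s ps {IH} => [|m s] //= /andP[/negPf-> _].
Qed.

Lemma foldr_push_inv s u :
  reduced s -> foldr push (foldr push s u) (inv_word u) = s.
Proof.
move=> rs; elim: u => //= l u IH; rewrite /inv_word map_cons rev_cons.
by rewrite foldr_rcons pushKV ?IH // foldr_push_reduced.
Qed.

Lemma inv_wordK : involutive inv_word.
Proof.
by move=> s; rewrite /inv_word map_rev revK mapK //; apply: inv_letterK.
Qed.

Lemma inv_word_reduced s : reduced s -> reduced (inv_word s).
Proof.
rewrite /reduced /inv_word rev_sorted sorted_map; apply: sub_sorted => l m /=.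
by rewrite inv_letterK eq_sym.
Qed.

Record free_group := FreeGroup { fword :> seq (X * bool); _ : reduced fword }.

HB.instance Definition _ := [isSub for fword].
HB.instance Definition _ := [Choice of free_group by <:].

Implicit Types v w : free_group.

Definition fg_one : free_group := @FreeGroup [::] isT.

Definition fg_mul v w : free_group :=
  FreeGroup (foldr_push_reduced v (valP w)).

Definition fg_inv v : free_group := FreeGroup (inv_word_reduced (valP v)).

Lemma fg_mulA : associative fg_mul.
Proof.
move=> [u ru] v w; apply: val_inj => /=; elim: u {ru} => //= l u ->.
by rewrite foldr_push_push //; apply: (valP w).
Qed.

Lemma fg_mul1 : left_id fg_one fg_mul.
Proof. by move=> w; apply: val_inj. Qed.

Lemma fg_mulr1 : right_id fg_one fg_mul.
Proof. by move=> w; apply: val_inj => /=; apply/foldr_push_id/(valP w). Qed.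

Lemma fg_mulV : left_inverse fg_one fg_inv fg_mul.
Proof.
move=> w; apply: val_inj => /=.
by rewrite -{1}(foldr_push_id (valP w)) foldr_push_inv.
Qed.

Lemma fg_mulrV : right_inverse fg_one fg_inv fg_mul.
Proof.
move=> w; rewrite -{1}[w](_ : fg_inv (fg_inv w) = w) ?fg_mulV //.
by apply: val_inj => /=; rewrite inv_wordK.
Qed.

HB.instance Definition _ := isGroup.Build free_group
  fg_mulA fg_mul1 fg_mulr1 fg_mulV fg_mulrV.

Definition fgen (x : X) : free_group := @FreeGroup [:: (x, false)] isT.

Theorem free_group_universal (G : groupType) (f : X -> G) :
  exists! h : free_group -> G,
    {morph h : v w / v * w} /\ (forall x, h (fgen x) = f x).
Proof.
pose el l : G := if l.2 then (f l.1)^-1 else f l.1.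
pose ev := foldr (fun l (g : G) => el l * g) 1.
have elV l : el l * el (inv_letter l) = 1.
  by case: l => x [] /=; rewrite /el /= ?mulVg ?mulgV.
have ev_push l s : ev (push l s) = el l * ev s.
  by case: s => [|m s] //=; case: eqP => [->|//]; rewrite mulgA elV mul1g.
exists (fun w => ev w); split; first split.
- move=> [u ru] w /=; elim: u {ru} => [|l u IH] /=; first by rewrite mul1g.
  by rewrite ev_push IH mulgA.
- by move=> x; rewrite /= /el /= mulg1.
move=> h [hM hf]; apply/funext => -[u ru].
have h1 : h 1 = 1 by apply: (mulgI (h 1)); rewrite -hM !mulg1.
have hV w : h w^-1 = (h w)^-1.
  by apply: (mulgI (h w)); rewrite -hM !mulgV.
elim: u ru => [|[x b] u IH] ru /=.
  by rewrite -h1; congr h; apply: val_inj.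
have ru' : reduced u by apply: path_sorted ru.
have -> : FreeGroup ru = (if b then (fgen x)^-1 else fgen x) * FreeGroup ru'.
  apply: val_inj => /=; case: b ru => ru;
    by case: u ru {IH ru'} => [|m u] //= /andP[/negPf-> _].
by rewrite hM -IH /= /el /=; case: (b); rewrite ?hV hf.
Qed.

End FreeGroup.

Section Subgroups.
Variable G : groupType.
Implicit Types (A H K N M Phi : set G) (w : G).

Definition is_subgroup H : Prop :=
  [/\ H 1, forall x y, H x -> H y -> H (x * y) & forall x, H x -> H x^-1].

Definition generated A : set G :=
  [set x | forall K, is_subgroup K -> A `<=` K -> K x].

Definition is_normal_subgroup N H : Prop :=
  [/\ is_subgroup N, N `<=` H & forall x h, N x -> H h -> N (x ^ h)].

Definition normal_closure A : set G :=
  [set x | forall M, is_normal_subgroup M [set: G] -> A `<=` M -> M x].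

Definition conj_class w K : set G := [set w ^ k | k in K].

(* The next two properties are meant for subgroups H of G. *)
Definition S_subgroup H : Prop :=
  exists2 w, H w & conj_class w H <> conj_class w [set: G] `&` H.

Definition ACEP H : Prop :=
  exists Phi, [/\ finite_set Phi, Phi `<=` H, ~ Phi 1 &
    forall N, is_normal_subgroup N H -> N `&` Phi = set0 ->
      H `&` normal_closure N = N].

Lemma generated_is_subgroup A : is_subgroup (generated A).
Proof.
split=> [K [] //|x y Ax Ay K sK AK|x Ax K sK AK]; case: (sK) => _ KM KV.
  by apply: KM; [apply: Ax|apply: Ay].
by apply: KV; apply: Ax.
Qed.

End Subgroups.

(* Main.v *)
Require Import Defs.
From mathcomp Require Import all_boot.
From mathcomp Require Import boolp classical_sets cardinality.
From mathcomp Require Import ssralg ssrnum ssrint zify.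

(** The subgroup H is read off its Stallings graph: a 4-cycle v0 v1 v2 v3 of
a-edges, a b-edge from v2 to v3, a c-edge from v1 to v2, and both a b-edge and
a c-edge from v0 to a fifth vertex v4.  A reduced word lies in H exactly when
it labels a loop at v0 ([H_runsE]).

H is not an S-subgroup because a loop of the graph can be read at two distinct
vertices in only one way: reading a non-a-letter from two distinct vertices of
the cycle sends one of them to v4, and then the next letter has to backtrack.
So a word that can be read as a loop at i and at another vertex j is, up to
backtracking, a power of a; a path of a-edges from i to j commutes with it
([two_loops]).  If w and its conjugate by f are both loops, then either the
conjugation can be followed along the graph letter by letter, or the product
f^-1 w f is reduced as written, and then w is a loop at two vertices
([conj_runs]).

H does not have ACEP because of a singular equation.  H is free on x = a^4, B =
a^2 b a^-3, C = a c a^-2 and T = b c^-1, and F arises from H by adjoining a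
with the relations x = a^4 and T = a^-2 B a C^-1 a.  Let N be the normal
closure in H of the words saying C^-1 = x^(2n) B x^n and T^-1 = x^n B x^(2n),
so that H/N is free on x and B.  Modulo the normal closure of N in F, the
relation for T becomes, for m = 8n+1,
   (B a^m) (B a^m) (B a^m) = a^3.
So B a^m commutes with its cube a^3, hence B commutes with a^3, and with a^12 =
x^3 ([cube_relation]); but x^3 and B do not commute in the free group H/N.  A
given finite set of nontrivial elements of H misses N for large n: when C and T
are replaced by these long words in x and B, the letters B and B^-1 of a word
that is short compared with n never cancel.

To make H/N concrete, the free group on x and B is written as the semidirect
product of Z by the free group on the conjugates beta_k of B by powers of x.
Labelling the edges of the graph makes F act partially on pairs of a vertex and
an element of the semidirect product; N is realised as the [kernel] of the
action of H at v0, and [no_cancellation] is the invariant behind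
[lruns_faithful]. *)

Set Implicit Arguments.
Unset Strict Implicit.
Unset Printing Implicit Defensive.

Local Open Scope group_scope.
Local Open Scope classical_set_scope.

(** * Runs of an inverse automaton *)

Section Automaton.
Variables (X : choiceType) (T : Type) (step : X * bool -> T -> option T).
Hypothesis stepV :
  forall l s t, step l s = Some t -> step (inv_letter l) t = Some s.
Implicit Types (u : seq (X * bool)) (v w f : free_group X) (s t : T).

Fixpoint run (s : T) (u : seq (X * bool)) : option T :=
  if u is l :: u' then
    if step l s is Some t then run t u' else None
  else Some s.

Lemma run_cat s u u' : run s (u ++ u') = obind (run^~ u') (run s u).
Proof. by elim: u s => //= l u IH s; case: (step l s). Qed.

Lemma run_push l u s t : step l s = Some t -> run s (push l u) = run t u.
Proof.
move=> e; case: u => [|m u] /=; first by rewrite e.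
by case: eqP => [->|_] /=; [rewrite (stepV e) | rewrite e].
Qed.

(** Cancelling in a product never changes where a run ends, because every step
is undone by the inverse letter; so runs, although defined on reduced words,
compose like a partial right action. *)
Lemma run_mul v w s t : run s v = Some t -> run s (v * w) = run t w.
Proof.
rewrite [fword (v * w)]/=; elim: (fword v) s => [s [->] //|l u IH s] /=.
case e: (step l s) => [s'|] // /IH <-; exact: run_push.
Qed.

Lemma run_inv w s t : run s w = Some t -> run t w^-1 = Some s.
Proof.
rewrite [fword w^-1]/=; elim: (fword w) s => [s [->] //|l u IH s] /=.
case e: (step l s) => [s'|] // /IH et.
by rewrite /inv_word /= rev_cons -cats1 run_cat et /= (stepV e).
Qed.

Lemma run_conj w f s t :
  run s w = Some s -> run s f = Some t -> run t (w ^ f) = Some t.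
Proof.
move=> ew ef; rewrite conjgE (run_mul _ (run_inv ef)).
by rewrite (run_mul _ ew).
Qed.

Lemma run_expg w n (ss : nat -> T) :
  (forall m, run (ss m) w = Some (ss m.+1)) ->
  run (ss 0%N) (w ^+ n) = Some (ss n).
Proof.
move=> ew; elim: n => [|n IH]; first by rewrite expg0.
by rewrite expgSr (run_mul _ IH).
Qed.

End Automaton.

Arguments run {X T}.

(** * Reduced words *)

Section Letters.
Variable X : choiceType.

Definition fletter (l : X * bool) : free_group X := @FreeGroup X [:: l] isT.

Lemma fletterV l : fletter (inv_letter l) = (fletter l)^-1.
Proof. exact: val_inj. Qed.

Lemma free_group_ind (P : free_group X -> Prop) :
  P 1 ->
  (forall l (w : free_group X), reduced (l :: w) -> P w -> P (fletter l * w)) ->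
  forall w, P w.
Proof.
move=> P1 PM [u r]; elim: u r => [|l u IH] r.
  by have -> : FreeGroup r = 1 by apply: val_inj.
have r' : reduced u := path_sorted r.
have -> : FreeGroup r = fletter l * FreeGroup r'.
  apply: val_inj => /=; case: u r {IH r'} => //= m u /andP[/negPf ml _].
  by rewrite ml.
by apply: PM => //; apply: IH.
Qed.

Lemma reduced_cat (u v : seq (X * bool)) l :
  reduced u -> reduced v -> head l v != inv_letter (last (inv_letter l) u) ->
  reduced (u ++ v).
Proof.
case: u => [//|k u]; case: v => [|m v] ru rv /= mk; first by rewrite cats0.
by rewrite /reduced /= cat_path; apply/and3P.
Qed.

Lemma fword_reduced (w : free_group X) : reduced w.
Proof. exact: valP w. Qed.

Lemma fletter_mul l (w : free_group X) :
  reduced (l :: w) -> fword (fletter l * w) = l :: w.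
Proof. by move=> /=; case: (fword w) => //= m u /andP[/negPf->]. Qed.

Lemma fword_mul (v w : free_group X) :
  reduced (v ++ w) -> fword (v * w) = v ++ w.
Proof.
move=> r; rewrite -[RHS](foldr_push_id r) foldr_cat /=; congr foldr.
by rewrite foldr_push_id //; apply: fword_reduced.
Qed.

End Letters.

(** * Commutators in a normal closure *)

Section NormalClosure.
Variable G : groupType.
Implicit Types (A K : set G) (a B C g u : G).

Lemma subgroup_expg K u n : is_subgroup K -> K u -> K (u ^+ n).
Proof.
by move=> [K1 KM _] Ku; elim: n => // n IH; rewrite expgS; apply: KM.
Qed.

Lemma normal_closure_normal A : is_normal_subgroup (normal_closure A) [set: G].
Proof.
split=> //; first split.
- by move=> M [[]].
- move=> x y Ax Ay M nM AM; case: (nM) => -[_ MM _] _ _.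
  by apply: MM; [apply: Ax | apply: Ay].
- by move=> x Ax M nM AM; case: (nM) => -[_ _ MV] _ _; apply: MV; apply: Ax.
by move=> x h Ax _ M nM AM; case: (nM) => _ _ MJ; apply: MJ => //; apply: Ax.
Qed.

Lemma sub_normal_closure A : A `<=` normal_closure A.
Proof. by move=> x Ax M _; apply. Qed.

Lemma normal_commgX K u g n :
  is_normal_subgroup K [set: G] -> K [~ u, g] -> K [~ u ^+ n, g].
Proof.
move=> [[K1 KM KV] _ KJ] Ku; elim: n => [|n IH].
  by rewrite expg0 comm1g.
have -> : [~ u ^+ n.+1, g] = [~ u ^+ n, g] ^ u * [~ u, g].
  by rewrite !commgEl expgSr conjMg [_ ^ u]conjgE invgM !mulgA !mulgK.
by apply: (KM) => //; apply: (KJ).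
Qed.

(** Modulo K the two hypotheses read C^-1 = x^(2n) B x^n and
T^-1 = x^n B x^(2n).  Substituting them in T = a^-2 B a C^-1 a makes the three
gaps between successive B's equal to a^m, a^m and a^m a^-3, all because
2n = n + n; hence g = B a^m satisfies g^3 = a^3 modulo K and commutes with
a^3. *)
Lemma cube_relation K a B C n (x := a ^+ 4)
    (T := a ^- 2 * B * a * C^-1 * a) :
  is_normal_subgroup K [set: G] ->
  K (C * x ^+ (2 * n) * B * x ^+ n) -> K (T * x ^+ n * B * x ^+ (2 * n)) ->
  K [~ a ^+ 3, B].
Proof.
move=> [[K1 KM KV] _ KJ] KC KT.
pose m := (8 * n).+1; pose g := B * a ^+ m.
have Kg : K (g ^+ 3 * a ^- 3).
  (* The word g^3 a^-3 is, up to conjugation, the second relator with the first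
     one substituted for C^-1. *)
  set r1 := _ * _ in KC; set r2 := _ * _ in KT.
  pose q := a * x ^+ n * B * x ^+ (2 * n).
  have -> : g ^+ 3 * a ^- 3 = (r2 * r1 ^ q) ^ a ^- 2.
    have Er1 : C^-1 = x ^+ (2 * n) * B * x ^+ n * r1^-1.
      by rewrite /r1 !invgM !mulgA !mulgK mulgV mul1g.
    have -> : r2 = a ^- 2 * B * a * (x ^+ (2 * n) * B * x ^+ n) * r1^-1 * q.
      by rewrite /r2 /T Er1 /q !mulgA.
    have cancel p y z : p * y^-1 * z * y ^ z = p * z :> G.
      by rewrite conjgE -!mulgA mulVKg mulKg.
    have shift y z : (z ^- 2 * y * z^-1) ^ z ^- 2 = y * z ^- 3 :> G.
      by rewrite conjgE invgK !mulgA mulgV mul1g -mulgA -invgM -expgSr.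
    rewrite cancel.
    have -> : a ^- 2 * B * a * (x ^+ (2 * n) * B * x ^+ n) * q =
        a ^- 2 * g ^+ 3 * a^-1.
      have Em1 : a * x ^+ (2 * n) = a ^+ m.
        by rewrite /x -expgnA -expgS; congr (_ ^+ _); rewrite /m; lia.
      have Em2 : x ^+ n * a * x ^+ n = a ^+ m.
        rewrite /x -!expgnA -expgSr -expgnDr; congr (_ ^+ _).
        by rewrite /m; lia.
      have Em3 : x ^+ (2 * n) = a ^+ m * a^-1.
        by rewrite /x -!expgnA /m expgSr mulgK; congr (_ ^+ _); lia.
      transitivity (a ^- 2 * B * (a * x ^+ (2 * n)) * B * (x ^+ n * a * x ^+ n)
          * B * x ^+ (2 * n)); first by rewrite /q !mulgA.
      by rewrite Em1 Em2 Em3 [g ^+ 3]expgS expg2 /g !mulgA.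
    by rewrite shift.
  by apply: (KJ) => //; apply: (KM) => //; apply: (KJ).
(* With k = g^3 a^-3, the element a^3 = k^-1 g^3 is g^3 up to k, and g^3 is
   fixed by conjugation by g. *)
have -> : [~ a ^+ 3, B] =
    ((((g ^+ 3 * a ^- 3)^-1 ^ g) * (g ^+ 3 * a ^- 3)) ^ a ^- m) ^ a ^+ 3.
  set k := g ^+ 3 * a ^- 3.
  have Ek : k^-1 * g ^+ 3 = a ^+ 3 by rewrite /k invgM invgK mulgVK.
  have EB : B = g * a ^- m by rewrite /g mulgK.
  have am : a ^+ 3 ^ a ^- m = a ^+ 3.
    by apply/conjg_fixP/commgP/commuteV/commuteX2.
  have a3g : a ^+ 3 ^ g = k^-1 ^ g * k * a ^+ 3.
    rewrite -{1}Ek conjMg.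
    have -> : g ^+ 3 ^ g = g ^+ 3.
      by apply/conjg_fixP/commgP/commute_sym/commuteX.
    by rewrite -[RHS]mulgA; congr (_ * _); rewrite /k mulgVK.
  by rewrite commgEl {1}EB conjgM a3g conjMg am [RHS]conjgE mulgA.
by do 2!apply: (KJ) => //; apply: (KM) => //; apply: (KJ) => //; apply: KV.
Qed.

End NormalClosure.

(** * The Stallings graph of the subgroup *)

Section Stallings.

Notation letter := ('I_3 * bool)%type.
Notation F := (free_group 'I_3).
Let a : F := fgen (@Ordinal 3 0 isT).
Let b : F := fgen (@Ordinal 3 1 isT).
Let c : F := fgen (@Ordinal 3 2 isT).
Let H : set F :=
  generated [set a ^+ 4; a ^+ 2 * b * a; a * c * a ^+ 2; b * c^-1].

(** The vertices v0, ..., v3 stand for the cosets H, H a, H a^2, H a^3, and v4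
for the coset H b = H c. *)
Inductive vertex := v0 | v1 | v2 | v3 | v4.

Definition edge (l : letter) (i : vertex) : option vertex :=
  match val l.1, l.2, i with
  | 0, false, v0 => Some v1
  | 0, false, v1 => Some v2
  | 0, false, v2 => Some v3
  | 0, false, v3 => Some v0
  | 0, true, v1 => Some v0
  | 0, true, v2 => Some v1
  | 0, true, v3 => Some v2
  | 0, true, v0 => Some v3
  | 1, false, v2 => Some v3
  | 1, false, v0 => Some v4
  | 1, true, v3 => Some v2
  | 1, true, v4 => Some v0
  | 2, false, v1 => Some v2
  | 2, false, v0 => Some v4
  | 2, true, v2 => Some v1
  | 2, true, v4 => Some v0
  | _, _, _ => None
  end%N.

Lemma letterP (P : letter -> Prop) :
  (forall e, P (@Ordinal 3 0 isT, e)) -> (forall e, P (@Ordinal 3 1 isT, e)) ->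
  (forall e, P (@Ordinal 3 2 isT, e)) -> forall l, P l.
Proof.
move=> P0 P1 P2 [[[|[|[|//]]] p] e]; rewrite (bool_irrelevance p isT);
  by [apply: P0 | apply: P1 | apply: P2].
Qed.

Lemma edgeV l i j : edge l i = Some j -> edge (inv_letter l) j = Some i.
Proof. by elim/letterP: l => -[]; case: i => //= -[<-]. Qed.

Notation runs := (run edge).

(** Representatives of the cosets, read along a spanning tree of the graph. *)
Definition tree (i : vertex) : F :=
  match i with v0 => 1 | v1 => a | v2 => a ^+ 2 | v3 => a ^+ 3 | v4 => b end.

Lemma runs_tree i : runs v0 (tree i) = Some i.
Proof. by case: i; vm_compute. Qed.

Lemma subgroup_H : is_subgroup H. Proof. exact: generated_is_subgroup. Qed.

(** The Schreier generator attached to an edge: trivial on the spanning tree,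
and otherwise a generator of H or its inverse, up to a power of a^4. *)
Lemma H_tree_letter l i j : edge l i = Some j ->
  H (tree i * fletter l * (tree j)^-1).
Proof.
have [H1 HM HV] := subgroup_H.
have pos m k k' : m.2 = false -> edge m k = Some k' ->
    H (tree k * fletter m * (tree k')^-1).
  have Ha : H (a ^+ 4) by move=> K _; apply; do 3!left.
  have Hb : H (a ^+ 2 * b * a) by move=> K _; apply; do 2!left; right.
  have Hc : H (a * c * a ^+ 2) by move=> K _; apply; left; right.
  have Hbc : H (b * c^-1) by move=> K _; apply; right.
  elim/letterP: m => -[] //= _; case: k => //= -[<-].
  - by rewrite (_ : _ * _ = 1) //; apply: val_inj.
  - by rewrite (_ : _ * _ = 1) //; apply: val_inj.
  - by rewrite (_ : _ * _ = 1) //; apply: val_inj.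
  - by rewrite (_ : _ * _ = a ^+ 4) //; apply: val_inj.
  - by rewrite (_ : _ * _ = 1) //; apply: val_inj.
  - rewrite (_ : _ * _ = (a ^+ 2 * b * a) * (a ^+ 4)^-1); last exact: val_inj.
    by apply: HM => //; apply: HV.
  - rewrite (_ : _ * _ = (b * c^-1)^-1); last exact: val_inj.
    by apply: HV.
  - rewrite (_ : _ * _ = (a * c * a ^+ 2) * (a ^+ 4)^-1); last exact: val_inj.
    by apply: HM => //; apply: HV.
case: l => x [] e; last exact: pos.
have /HV := pos (x, false) _ _ erefl (edgeV e).
by rewrite !invgM invgK mulgA -fletterV.
Qed.

Lemma H_runs i j (w : F) : runs i w = Some j -> H (tree i * w * (tree j)^-1).
Proof.
have [H1 HM HV] := subgroup_H.
elim/free_group_ind: w i => [i [<-]|l w r IH i].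
  by rewrite mulg1 mulgV.
rewrite fletter_mul //=; case e: (edge l i) => [k|] // /IH Hw.
have := HM _ _ (H_tree_letter e) Hw.
by rewrite !mulgA mulgVK.
Qed.

Lemma H_runsE (w : F) : H w <-> runs v0 w = Some v0.
Proof.
split=> [Hw|/H_runs]; last by rewrite /= invg1 mulg1 mul1g.
apply: (Hw [set u : F | runs v0 u = Some v0]).
  split=> //= [x y ex ey|x ex]; first by rewrite (run_mul edgeV _ ex).
  exact: (run_inv edgeV).
by move=> u [[[->|->]|->]|->]; vm_compute.
Qed.

Lemma runs_between i j : exists k : F, runs i k = Some j.
Proof.
exists ((tree i)^-1 * tree j).
by rewrite (run_mul edgeV _ (run_inv edgeV (runs_tree i))) runs_tree.
Qed.

(** * Conjugate loops of the graph *)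

Definition on_cycle i : bool := if i is v4 then false else true.

(** From two distinct vertices of the cycle, a b- or c-letter leads to a pair of
vertices one of which is v4; the only letter that can be read from both of them
is the inverse of the one just read.  So a reduced word which returns to the
cycle uses only a and a^-1. *)
Lemma two_runs_commute (w : F) i j i' j' :
  i <> j -> on_cycle i -> on_cycle j -> on_cycle i' -> on_cycle j' ->
  runs i w = Some i' -> runs j w = Some j' -> commute w a.
Proof.
elim/free_group_ind: w i j => [|l w r IH] i j ij ci cj ci' cj'.
  by move=> _ _; apply: commute_sym; apply: commute1.
rewrite fletter_mul //=.
case ei: (edge l i) => [i1|] //; case ej: (edge l j) => [j1|] // ri rj.
have ij1 : i1 <> j1.
  by move=> e; move: (edgeV ei) (edgeV ej); rewrite e => -> [].
have [/andP[ci1 cj1]|/negP nc] := boolP (on_cycle i1 && on_cycle j1).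
  have la : commute (fletter l) a.
    apply: val_inj.
    move: ij ci cj ei ej ci1 cj1.
    by elim/letterP: l {r} => -[]; case: i; case: j => //= _ _ _ [<-] [<-].
  by apply/commute_sym/commuteM; apply: commute_sym => //; apply: (IH i1 j1).
case: (fword w) r ri rj => [|m u] /=.
  by move=> _ [e1] [e2]; case: nc; rewrite e1 e2 ci'.
move=> /andP[+ _]; case em: (edge m i1) => [i2|] //.
case em': (edge m j1) => [j2|] //.
move=> /eqP + _ _; case.
move: ij ci cj ei ej em em' nc.
by elim/letterP: l => -[]; case: i; case: j => //= _ _ _ [<-] [<-] //;
  elim/letterP: m => -[].
Qed.

(** On the cycle w is a power of a, and the path of a-edges from i to j serves
as k.  If one of i, j is v4, conjugating w by its first letter moves both loops
to the cycle. *)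
Lemma two_loops (w : F) i j : runs i w = Some i -> runs j w = Some j ->
  exists2 k : F, runs i k = Some j & w ^ k = w.
Proof.
move=> wi wj; case: (pselect (i = j)) => [<-|ij].
  by exists 1 => //; rewrite conjg1.
have core (v : F) i1 j1 : i1 <> j1 -> on_cycle i1 -> on_cycle j1 ->
    runs i1 v = Some i1 -> runs j1 v = Some j1 ->
    exists2 k : F, runs i1 k = Some j1 & v ^ k = v.
  move=> ij1 c1 c2 r1 r2; exists ((tree i1)^-1 * tree j1).
    by rewrite (run_mul edgeV _ (run_inv edgeV (runs_tree i1))) runs_tree.
  have va := two_runs_commute ij1 c1 c2 c1 c2 r1 r2.
  have vt m : on_cycle m -> commute v (tree m).
    by case: m => //= _; [exact: commute1 | exact: commuteX | exact: commuteX].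
  apply/conjg_fixP/commgP/commuteM; last exact: vt.
  by apply: commuteV; apply: vt.
have [/andP[ci cj]|/negP nc] := boolP (on_cycle i && on_cycle j).
  exact: core.
have [->|w1] := pselect (w = 1).
  by have [k rk] := runs_between i j; exists k; rewrite ?conj1g.
have [l [i1 [j1 [ei ej]]]] :
    exists l i1 j1, edge l i = Some i1 /\ edge l j = Some j1.
  case: w w1 wi wj => -[|l u] r w1 /=; first by case: w1; apply: val_inj.
  case ei: (edge l i) => [i1|] // _; case ej: (edge l j) => [j1|] // _.
  by exists l, i1, j1.
have rl k k' : edge l k = Some k' -> runs k (fletter l) = Some k'.
  by move=> /= ->.
have [] := core (w ^ fletter l) i1 j1.
- by move=> e; move: (edgeV ei) (edgeV ej); rewrite e => -> [].
- move: ij nc ei ej; elim/letterP: l {rl} => -[];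
  by case: i {wi}; case: j {wj} => //= _ _ [<-] _.
- move: ij nc ei ej; elim/letterP: l {rl} => -[];
  by case: i {wi}; case: j {wj} => //= _ _ _ [<-].
- by apply: (run_conj edgeV wi); apply: rl.
- by apply: (run_conj edgeV wj); apply: rl.
move=> k rk ek; exists (fletter l * k * (fletter l)^-1).
  rewrite -mulgA (run_mul edgeV _ (rl _ _ ei)) (run_mul edgeV _ rk).
  by apply: (run_inv edgeV); apply: rl.
by rewrite !conjgM ek -conjgM mulgV conjg1.
Qed.

(** Induction on the conjugator f = l f'.  If the letter l can be read at i,
then conjugating w by l moves the loop w along that edge and leaves f' to deal
with. If not, w neither starts with l nor ends with its inverse, so f^-1 w f is
reduced as written; reading it as a loop at j makes w a loop at the vertex
where f^-1 ends. *)
Lemma conj_runs (f w : F) i j :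
  runs i w = Some i -> runs j (w ^ f) = Some j ->
  exists2 k : F, runs i k = Some j & w ^ k = w ^ f.
Proof.
elim/free_group_ind: f w i => [|l f rf IH] w i wi.
  by rewrite conjg1; apply: two_loops.
case e: (edge l i) => [i1|].
  have rl : runs i (fletter l) = Some i1 by rewrite /= e.
  rewrite conjgM => /(IH _ _ (run_conj edgeV wi rl))[k rk <-].
  by exists (fletter l * k); rewrite ?conjgM // (run_mul edgeV _ rl).
have [->|w1] := pselect (w = 1).
  by have [k rk] := runs_between i j; exists k; rewrite ?conj1g.
have Erf := fletter_mul rf; set g := fletter l * f in Erf *.
have [l1 [s1 ws1]] : exists l1 s1, fword w = l1 :: s1.
  case: w w1 {IH wi} => -[|l1 s1] r w1; last by exists l1, s1.
  by case: w1; apply: val_inj.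
have [l2 [s2 ws2]] : exists l2 s2, fword w = rcons s2 l2.
  by rewrite ws1 lastI; exists (last l1 s1), (belast l1 s1).
have ne1 : l1 != l by apply/eqP => el; move: wi; rewrite ws1 /= el e.
have ne2 : l2 != inv_letter l.
  apply/eqP => el2; move: (run_inv edgeV wi).
  by rewrite /= /inv_word ws2 map_rcons rev_rcons /= el2 inv_letterK e.
have rwg : reduced (w ++ g).
  apply: (@reduced_cat _ _ _ l (fword_reduced w) (fword_reduced g)).
  rewrite Erf ws2 last_rcons /=.
  by rewrite -(inj_eq (can_inj (@inv_letterK _))) inv_letterK eq_sym.
have red : reduced (inv_word g ++ w ++ g).
  apply: (@reduced_cat _ _ _ l (inv_word_reduced (fword_reduced g)) rwg).
  by rewrite Erf ws1 /inv_word rev_cons last_rcons /= inv_letterK.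
have -> : w ^ g = g^-1 * (w * g) by [].
have Ewg := fword_mul rwg.
rewrite fword_mul Ewg // run_cat.
case e1 : (run _ _ _) => [j1|] //=.
rewrite run_cat; case e2 : (run _ _ _) => [j2|] //= e3.
have j12 : j1 = j2.
  have e3' : runs j g^-1 = Some j2 := run_inv edgeV (e3 : runs j2 g = Some j).
  by move: e1; rewrite e3' => -[].
subst j2.
have [k rk ek] := two_loops wi e2.
exists (k * g); first by rewrite (run_mul edgeV _ rk).
by rewrite conjgM ek.
Qed.

Lemma not_S_subgroup : ~ S_subgroup H.
Proof.
case=> w Hw; case; apply/seteqP; split=> [_ [k Hk <-]|_ [[f _ <-] Hf]].
  have [H1 HM HV] := subgroup_H.
  by split; [exists k | apply: (HM); [apply: HV | apply: (HM)]].
have [k rk <-] := conj_runs (proj1 (H_runsE w) Hw) (proj1 (H_runsE _) Hf).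
by exists k => //; apply/H_runsE.
Qed.

(** * The labelled graph *)

(** A pair (k, w) is an element of the semidirect product of Z by the free group
on the letters beta_k, for k in Z; multiplication by x adds 4 to k and
multiplication by B prepends beta_k to w. *)
Notation conf := (int * free_group int)%type.

Section Labels.
Variable M : int.

Definition strike (off : int) (e : bool) (inc : int) (s : conf) : conf :=
  ((s.1 + inc)%R, fletter ((s.1 + off)%R, e) * s.2).

(** Each a-edge adds 1 to the counter, so that x = a^4 adds 4, and the labels of
the other edges are chosen so that the loops B, C and T act as B,
x^-M B^-1 x^(-2M) and x^(-2M) B^-1 x^-M: see [lruns_B], [lruns_C] and
[lruns_T]. *)
Definition act (l : letter) (i : vertex) : conf -> conf :=
  match val l.1, l.2, i with
  | 0%N, e, _ => fun s => ((s.1 + (if e then -1 else 1))%R, s.2)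
  | 1%N, false, v2 => strike (-2) false 1
  | 1%N, true, v3 => strike (-3) true (-1)
  | 1%N, false, v0 => strike (- 8 * M) true (- 12 * M)
  | 1%N, true, v4 => strike (4 * M) false (12 * M)
  | 2%N, false, v1 => strike (- 1 - 4 * M) true (1 - 12 * M)
  | 2%N, true, v2 => strike (8 * M - 2) false (12 * M - 1)
  | _, _, _ => id
  end%R.

Definition labelled_edge (l : letter) (p : vertex * conf) :
    option (vertex * conf) :=
  omap (pair^~ (act l p.1 p.2)) (edge l p.1).

Lemma strikeK off e inc s :
  strike (off - inc)%R (~~ e) (- inc)%R (strike off e inc s) = s.
Proof.
case: s => k w; rewrite /strike /=; congr (_, _); first by lia.
rewrite (_ : _ + inc + _ = k + off)%R; last by lia.
by rewrite -[(_, ~~ e)]/(inv_letter (_, e)) fletterV mulKg.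
Qed.

Lemma labelled_edgeV l p q :
  labelled_edge l p = Some q -> labelled_edge (inv_letter l) q = Some p.
Proof.
case: p => i s; rewrite /labelled_edge /=.
case e: (edge l i) => [j|] //= [<-] /=.
rewrite (edgeV e) /= /act; congr (Some (_, _)).
have eq_strike off inc d s' off' inc' :
    (off' = off - inc)%R -> (inc' = - inc)%R ->
    strike off' (~~ d) inc' (strike off d inc s') = s'.
  by move=> -> ->; apply: strikeK.
have eq_a (x y : int) : (x + y = 0)%R -> ((s.1 + x + y)%R, s.2) = s.
  by case: s => k w xy /=; congr (_, _); lia.
elim/letterP: l e => -[] //=; case: i => //= -[?]; subst j; move=> /=;
  solve [done | apply: eq_a; lia | apply: (eq_strike _ _ false); lia
        | apply: (eq_strike _ _ true); lia].
Qed.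

Notation lruns := (run labelled_edge).

Lemma lruns_exists i j s u :
  run edge i u = Some j -> exists t, lruns (i, s) u = Some (j, t).
Proof.
elim: u i s => [|l u IH] i s /=; first by case=> <-; exists s.
rewrite /labelled_edge /=; case e: (edge l i) => [k|] //= /IH; exact.
Qed.

(** * Short words do not cancel *)

(** What the last letter l read, ending at i with state (k, u), says about the
drift k - k0 of the counter from the first letter (k0, e) of u.  Right after a
strike the drift is the constant attached to that edge.  Before the first
strike the word is a power of a, which k counts, possibly followed by c.  The
c-edge from v0 to v4 and its inverse do not strike: the former cannot follow
the latter, which can only come after the b-edge into v4. *)
Definition last_letter_ok (l : letter) (i : vertex) (k : int)
    (u : seq (int * bool)) : Prop :=
  match u with
  | [::] =>
    match val l.1, l.2, i with
    | 0%N, _, v4 => False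
    | 0%N, false, _ => (0 < k)%R
    | 0%N, true, _ => (k < 0)%R
    | 2%N, false, v4 => True
    | _, _, _ => False
    end
  | (k0, e) :: _ =>
    match val l.1, l.2, i with
    | 0%N, _, v4 => False
    | 0%N, d, _ => True
    | 1%N, false, v3 => e = false /\ (k - k0 = 3)%R
    | 1%N, true, v2 => e = true /\ (k - k0 = 2)%R
    | 1%N, false, v4 => e = true /\ (k - k0 = - 4 * M)%R
    | 1%N, true, v0 => e = false /\ (k - k0 = 8 * M)%R
    | 2%N, false, v2 => e = true /\ (k - k0 = 2 - 8 * M)%R
    | 2%N, true, v1 => e = false /\ (k - k0 = 1 + 4 * M)%R
    | 2%N, false, v4 => ~ (e = true /\ (k - k0 = - 4 * M)%R)
    | 2%N, true, v0 => e = true /\ (k - k0 = - 4 * M)%R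
    | _, _, _ => False
    end
  end.

(** The drift is one of the three constants of strikes of sign e, plus the
signed number j of letters a read since.  As the word is reduced these letters
all have the same sign, so j is nonzero if the last letter was one of them. *)
Definition drift_ok (n : nat) (l : letter) k (u : seq (int * bool)) : Prop :=
  if u is (k0, e) :: _ then
    exists j : int, [/\ (- n%:Z <= j <= n%:Z)%R,
      (l.1 = 0%N :> nat -> if l.2 then (j < 0)%R else (0 < j)%R) &
      (let d := k - k0 - j in
       if e then d = 2 \/ d = 2 - 8 * M \/ d = - 4 * M
       else d = 3 \/ d = 1 + 4 * M \/ d = 8 * M)%R]
  else True.

(** A strike of sign opposite to the first letter (k0, e) cancels it only if the
drift is the constant of the inverse strike.  The three constants of a given
sign are far apart compared with j, so this needs j = 0 and the inverse edge,
that is, backtracking.  Hence the free group element only grows. *)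
Lemma no_cancellation n l i (s : conf) m j t :
  (n%:Z + 4 < M)%R -> last_letter_ok l i s.1 s.2 -> drift_ok n l s.1 s.2 ->
  m != inv_letter l -> labelled_edge m (i, s) = Some (j, t) ->
  last_letter_ok m j t.1 t.2 /\ drift_ok n.+1 m t.1 t.2.
Proof.
case: s => k [u ru]; rewrite /labelled_edge /= => nM ok off ml.
case e: (edge m i) => [i'|] //= -[<- <-] {j t}.
case: u ru ok off => [|[k0 d] u] ru.
  rewrite /= => ok _.
  elim/letterP: m ml e => -[]; elim/letterP: l ok => -[];
  case: i => //= ok _ [<-] /=; split=> //; try lia;
  try (by split=> //; lia); by exists 0%R; split=> //; lia.
(* In the surviving cases the new value of j is x - 1 or x + 1 after an
   a-letter, 0 after a strike, and x after the c-edge from v0 to v4 or its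
   inverse. *)
case: d ru => ru ok [x [xn xl xk]];
  elim/letterP: m ml e => -[]; elim/letterP: l ok xl => -[];
  case: i => //= ok xl _ [<-] /=;
  rewrite ?xpair_eqE ?andbF ?andbT /=; try (case: eqP => /= kk);
  try (by exfalso; lia); split; try (by split=> //; lia); try lia;
  by [exists (x - 1)%R; split=> //; lia | exists (x + 1)%R; split=> //; lia
     | exists 0%R; split=> //; lia | exists x; split=> //; lia].
Qed.

End Labels.

Notation lruns M := (run (labelled_edge M)).

Lemma lruns_faithful (M : int) (w : F) : ((size w)%:Z + 5 < M)%R ->
  lruns M (v0, (0%R, 1)) w = Some (v0, (0%R, 1)) -> w = 1.
Proof.
have main u n l i (s : conf) :
  ((n + size u)%:Z + 4 < M)%R -> reduced (l :: u) ->
  last_letter_ok M l i s.1 s.2 -> drift_ok M n l s.1 s.2 ->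
  lruns M (i, s) u <> Some (v0, (0%R, 1)).
  elim: u n l i s => [|m u IH] n l i s nM ru ok off /=.
    by case=> ei es; move: ok; rewrite ei es; elim/letterP: l {ru off} => -[].
  case: ru => /andP[ml ru]; case e: (labelled_edge M m (i, s)) => [[j t]|] //.
  have [|ok' off'] := no_cancellation _ ok off ml e.
    by move: nM => /=; lia.
  by apply: IH ru ok' off'; move: nM => /=; lia.
case: w => -[|l u] ru sM /=; first by move=> _; apply: val_inj.
case e: (labelled_edge M l (v0, (0%R, 1))) => [[j t]|] //.
have [] : last_letter_ok M l j t.1 t.2 /\ drift_ok M 1 l t.1 t.2.
  move: e; rewrite /labelled_edge; elim/letterP: l {ru sM} => -[] //= -[<- <-];
  split=> //=; try by split=> //; lia.
  by exists 0%R; split=> //; lia.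
move=> ok off /(main _ 1%N _ _ _ _ ru ok off); case.
by move: sM => /=; lia.
Qed.

Lemma lruns_H M (h : F) s : H h -> exists t, lruns M (v0, s) h = Some (v0, t).
Proof. by move/H_runsE; apply: lruns_exists. Qed.

(** * Failure of the congruence extension property *)

Definition kernel M : set F :=
  [set w | H w /\ forall s, lruns M (v0, s) w = Some (v0, s)].

Lemma kernel_normal M : is_normal_subgroup (kernel M) H.
Proof.
have [H1 HM HV] := subgroup_H.
split; first split.
- by split.
- move=> u v [Hu ru] [Hv rv]; split; first exact: HM.
  by move=> s; rewrite (run_mul (@labelled_edgeV M) _ (ru s)).
- move=> u [Hu ru]; split; first exact: HV.
  by move=> s; apply: (run_inv (@labelled_edgeV M)).
- by move=> u [].
move=> u h [Hu ru] Hh; split; first by apply: (HM); [apply: HV | apply: (HM)].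
move=> s; have [t et] := lruns_H M s (HV _ Hh).
have := run_inv (@labelled_edgeV M) et; rewrite invgK => et'.
exact: (run_conj (@labelled_edgeV M) (ru t) et').
Qed.

Let B := a ^+ 2 * b * a ^- 3.
Let C := a * c * a ^- 2.
Let T := b * c^-1.

Lemma lruns_B M k w :
  lruns M (v0, (k, w)) B = Some (v0, (k, fletter (k, false) * w)).
Proof.
rewrite /= /act /strike /=; congr (Some (_, (_, fletter (_, _) * _))); lia.
Qed.

Lemma lruns_C M k w : lruns M (v0, (k, w)) C =
  Some (v0, (k - 12 * M, fletter (k - 4 * M, true) * w)%g)%R.
Proof.
rewrite /= /act /strike /=; congr (Some (_, (_, fletter (_, _) * _))); lia.
Qed.

Lemma lruns_T M k w : lruns M (v0, (k, w)) T =
  Some (v0, (k - 12 * M, fletter (k - 8 * M, true) * w)%g)%R.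
Proof.
rewrite /= /act /strike /=; congr (Some (_, (_, fletter (_, _) * _))); lia.
Qed.

Lemma lruns_x M k w n :
  lruns M (v0, (k, w)) (a ^+ 4 ^+ n) = Some (v0, (k + 4 * n%:Z, w))%R.
Proof.
rewrite [in LHS](_ : k = k + 4 * 0%:Z)%R; last by lia.
pose ss (m : nat) : vertex * conf := (v0, ((k + 4 * m%:Z)%R, w)).
rewrite (@run_expg _ _ _ (@labelled_edgeV M) (a ^+ 4) n ss) //.
move=> m; rewrite /= /act /=; congr (Some (_, (_, _))); lia.
Qed.

Let x := a ^+ 4.

Lemma H_gens : [/\ H x, H B, H C & H T].
Proof. by split; apply/H_runsE. Qed.

Lemma kernel_C (n : nat) : kernel n (C * x ^+ (2 * n) * B * x ^+ n).
Proof.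
have [Hx HB HC _] := H_gens; have [H1 HM HV] := subgroup_H.
have HX m : H (x ^+ m) := subgroup_expg m subgroup_H Hx.
split; first by do !apply: (HM) => //.
case=> k w; have V := @labelled_edgeV n.
rewrite -!mulgA (run_mul V _ (lruns_C _ _ _)) (run_mul V _ (lruns_x _ _ _ _)).
rewrite (run_mul V _ (lruns_B _ _ _)) lruns_x.
congr (Some (_, (_, _))).
  by lia.
rewrite (_ : _ + _ = k - 4 * n%:Z)%R; last by lia.
by rewrite -[(_, true)]/(inv_letter (_, false)) fletterV mulVKg.
Qed.

Lemma kernel_T (n : nat) : kernel n (T * x ^+ n * B * x ^+ (2 * n)).
Proof.
have [Hx HB _ HT] := H_gens; have [H1 HM HV] := subgroup_H.
have HX m : H (x ^+ m) := subgroup_expg m subgroup_H Hx.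
split; first by do !apply: (HM) => //.
case=> k w; have V := @labelled_edgeV n.
rewrite -!mulgA (run_mul V _ (lruns_T _ _ _)) (run_mul V _ (lruns_x _ _ _ _)).
rewrite (run_mul V _ (lruns_B _ _ _)) lruns_x.
congr (Some (_, (_, _))).
  by lia.
rewrite (_ : _ + _ = k - 8 * n%:Z)%R; last by lia.
by rewrite -[(_, true)]/(inv_letter (_, false)) fletterV mulVKg.
Qed.

Lemma commutator_notin_kernel M : ~ kernel M [~ x ^+ 3, B].
Proof. by case=> _ /(_ (0%R, 1)); vm_compute. Qed.

Lemma not_ACEP : ~ ACEP H.
Proof.
case=> Phi [finPhi PhiH Phi1 ext].
have [n nP] : exists n, forall w : F, Phi w -> (size w + 5 < n)%N.
  have /finite_seqP[s ->] := finPhi.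
  exists (\max_(w <- s) (size (fword w)) + 6)%N => w /= ws.
  rewrite [X in (_ < X)%N]addnS ltnS leq_add2r.
  exact: (@leq_bigmax_seq _ s xpredT (fun w : F => size w)).
have NPhi : kernel n `&` Phi = set0.
  apply/seteqP; split=> // w [[_ /(_ (0%R, 1)) rw] Pw].
  case: Phi1; rewrite -(lruns_faithful _ rw) //; have := nP _ Pw; lia.
have eN := ext _ (kernel_normal n) NPhi.
apply: (@commutator_notin_kernel n); rewrite -eN; split.
  have [Hx HB _ _] := H_gens; have [H1 HM HV] := subgroup_H.
  have Hx3 : H (x ^+ 3) := subgroup_expg 3 subgroup_H Hx.
  by rewrite commgEl conjgE; do 3?apply: (HM) => //; apply: HV.
have K := normal_closure_normal (kernel n).
have sub := @sub_normal_closure _ (kernel n).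
rewrite /x expgnAC; apply: normal_commgX (K) _.
apply: (cube_relation K (n := n) (C := C)).
  by apply: sub; apply: kernel_C.
rewrite (_ : _ * a = T); last exact: val_inj.
by apply: sub; apply: kernel_T.
Qed.

End Stallings.

Theorem proposition4 :
  let a : free_group 'I_3 := fgen (@Ordinal 3 0 isT) in
  let b : free_group 'I_3 := fgen (@Ordinal 3 1 isT) in
  let c : free_group 'I_3 := fgen (@Ordinal 3 2 isT) in
  let H : set (free_group 'I_3) :=
    generated [set a ^+ 4; a ^+ 2 * b * a; a * c * a ^+ 2; b * c^-1] in
  ~ S_subgroup H /\ ~ ACEP H.
Proof. by split; [exact: not_S_subgroup | exact: not_ACEP]. Qed.
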